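(* Let $n\ge 1$ and let $\mathfrak{el}_{2n}$ be the Lie algebra over $\mathbb{R}$ generated by $e_1,\dots,e_{2n}$ subject to the relations $[e_i,e_j]=0$ for $|i-j|>1$ and $[e_i,[e_i,e_j]]=-2e_i$ for $|i-j|=1$. Then $\mathfrak{el}_{2n}$ is isomorphic, as a real Lie algebra, to the real symplectic Lie algebra $\mathfrak{sp}_{2n}$.
   Context: $\mathfrak{sp}_{2n}$ is the Lie algebra of real $2n\times 2n$ matrices which in $n\times n$ block form $\begin{pmatrix} A&B\\ C&D\end{pmatrix}$ satisfy $A=-D^T$, $B=B^T$, $C=C^T$. *)

(* Defs.v *)
From HB Require Import structures.
From mathcomp Require Import all_boot all_order all_algebra.
From mathcomp Require Import boolp reals.
From mathcomp Require Import ring.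

Set Implicit Arguments.
Unset Strict Implicit.
Unset Printing Implicit Defensive.

Import GRing.Theory.
Local Open Scope ring_scope.

HB.mixin Record Lmodule_isLieAlgebra (R : comNzRingType) L
    of GRing.Lmodule R L := {
  lieb : L -> L -> L;
  liebPl : forall (a : R) (x y z : L),
    lieb (a *: x + y) z = a *: lieb x z + lieb y z;
  liebPr : forall (a : R) (x y z : L),
    lieb z (a *: x + y) = a *: lieb z x + lieb z y;
  liebxx : forall x : L, lieb x x = 0;
  lieb_jacobi : forall x y z : L,
    lieb x (lieb y z) + lieb y (lieb z x) + lieb z (lieb x y) = 0
}.

#[short(type="lieAlgType")]
HB.structure Definition LieAlgebra (R : comNzRingType) :=
  { L of Lmodule_isLieAlgebra R L & GRing.Lmodule R L }.

Definition is_lie_morphism (R : comNzRingType) (L1 L2 : lieAlgType R)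
    (f : L1 -> L2) : Prop :=
  [/\ forall x y : L1, f (x + y) = f x + f y,
      forall (a : R) (x : L1), f (a *: x) = a *: f x
    & forall x y : L1, f (lieb x y) = lieb (f x) (f y)].

Definition lie_isomorphic (R : comNzRingType) (L1 L2 : lieAlgType R) : Prop :=
  exists f : L1 -> L2, is_lie_morphism f /\ bijective f.

(* Lie algebras given by generators and relations: [lie_pres r] is the set of
   formal Lie expressions in the generators [I], modulo the least congruence
   containing the Lie algebra identities and the relations [r s t], each read
   as [s = t].  Its universal property is [lie_pres_univ] below.  The opposite
   of [t] is encoded as [(-1) *: t]. *)
Section Presentation.
Variables (R : comNzRingType) (I : Type).

Inductive lterm : Type :=
  | LGen of I
  | LZero
  | LAdd of lterm & lterm
  | LScale of R & lterm
  | LBrack of lterm & lterm.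

HB.instance Definition _ := gen_eqMixin lterm.
HB.instance Definition _ := gen_choiceMixin lterm.

Inductive lcong (r : lterm -> lterm -> Prop) : lterm -> lterm -> Prop :=
  | lc_rel s t : r s t -> lcong r s t
  | lc_refl s : lcong r s s
  | lc_sym s t : lcong r s t -> lcong r t s
  | lc_trans s t u : lcong r s t -> lcong r t u -> lcong r s u
  | lc_add s s' t t' :
      lcong r s s' -> lcong r t t' -> lcong r (LAdd s t) (LAdd s' t')
  | lc_scale a s s' : lcong r s s' -> lcong r (LScale a s) (LScale a s')
  | lc_brack s s' t t' :
      lcong r s s' -> lcong r t t' -> lcong r (LBrack s t) (LBrack s' t')
  | lc_addA s t u : lcong r (LAdd s (LAdd t u)) (LAdd (LAdd s t) u)
  | lc_addC s t : lcong r (LAdd s t) (LAdd t s)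
  | lc_add0 s : lcong r (LAdd LZero s) s
  | lc_addN s : lcong r (LAdd (LScale (-1) s) s) LZero
  | lc_scaleA a b s : lcong r (LScale a (LScale b s)) (LScale (a * b) s)
  | lc_scale1 s : lcong r (LScale 1 s) s
  | lc_scaleDr a s t :
      lcong r (LScale a (LAdd s t)) (LAdd (LScale a s) (LScale a t))
  | lc_scaleDl s a b :
      lcong r (LScale (a + b) s) (LAdd (LScale a s) (LScale b s))
  | lc_brackPl a s t u :
      lcong r (LBrack (LAdd (LScale a s) t) u)
              (LAdd (LScale a (LBrack s u)) (LBrack t u))
  | lc_brackPr a s t u :
      lcong r (LBrack u (LAdd (LScale a s) t))
              (LAdd (LScale a (LBrack u s)) (LBrack u t))
  | lc_brackxx s : lcong r (LBrack s s) LZero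
  | lc_jacobi s t u :
      lcong r (LAdd (LAdd (LBrack s (LBrack t u)) (LBrack t (LBrack u s)))
                    (LBrack u (LBrack s t))) LZero.

Variable r : lterm -> lterm -> Prop.

Definition lcongb (s t : lterm) : bool := `[< lcong r s t >].

Lemma lcongb_refl : reflexive lcongb.
Proof. by move=> s; apply/asboolP; exact: lc_refl. Qed.

Lemma lcongb_sym : symmetric lcongb.
Proof. by move=> s t; apply/asboolP/asboolP; exact: lc_sym. Qed.

Lemma lcongb_trans : transitive lcongb.
Proof.
by move=> t s u /asboolP st /asboolP tu; apply/asboolP; exact: lc_trans st tu.
Qed.

Canonical lcong_equiv := EquivRel lcongb lcongb_refl lcongb_sym lcongb_trans.

Definition lie_pres := {eq_quot lcong_equiv}%qT.

HB.instance Definition _ := Choice.on lie_pres.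

Definition lp_class (s : lterm) : lie_pres := (\pi_{eq_quot lcong_equiv} s)%qT.

Definition lp_repr (x : lie_pres) : lterm :=
  repr (x : {eq_quot lcong_equiv}%qT).

Lemma lp_reprK x : lp_class (lp_repr x) = x.
Proof. exact: reprK. Qed.

Lemma lp_classP s t : lp_class s = lp_class t <-> lcong r s t.
Proof.
split=> [/eqquotP/asboolP // | h].
by apply/eqquotP/asboolP.
Qed.

Lemma lp_classK s : lcong r (lp_repr (lp_class s)) s.
Proof. by apply/lp_classP; rewrite lp_reprK. Qed.

Definition lp_add (x y : lie_pres) := lp_class (LAdd (lp_repr x) (lp_repr y)).
Definition lp_scale (a : R) (x : lie_pres) := lp_class (LScale a (lp_repr x)).
Definition lp_brack (x y : lie_pres) :=
  lp_class (LBrack (lp_repr x) (lp_repr y)).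

Lemma lp_addE s t : lp_add (lp_class s) (lp_class t) = lp_class (LAdd s t).
Proof. by apply/lp_classP; apply: lc_add; exact: lp_classK. Qed.

Lemma lp_scaleE a s : lp_scale a (lp_class s) = lp_class (LScale a s).
Proof. by apply/lp_classP; apply: lc_scale; exact: lp_classK. Qed.

Lemma lp_brackE s t :
  lp_brack (lp_class s) (lp_class t) = lp_class (LBrack s t).
Proof. by apply/lp_classP; apply: lc_brack; exact: lp_classK. Qed.

Lemma lp_ind (P : lie_pres -> Prop) :
  (forall s, P (lp_class s)) -> forall x, P x.
Proof. by move=> h x; rewrite -(lp_reprK x). Qed.

Fact lp_addA : associative lp_add.
Proof.
elim/lp_ind=> s; elim/lp_ind=> t; elim/lp_ind=> u; rewrite !lp_addE.
by apply/lp_classP; exact: lc_addA.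
Qed.

Fact lp_addC : commutative lp_add.
Proof.
elim/lp_ind=> s; elim/lp_ind=> t; rewrite !lp_addE.
by apply/lp_classP; exact: lc_addC.
Qed.

Fact lp_add0 : left_id (lp_class LZero) lp_add.
Proof.
by elim/lp_ind=> s; rewrite lp_addE; apply/lp_classP; exact: lc_add0.
Qed.

Fact lp_addN : left_inverse (lp_class LZero) (lp_scale (-1)) lp_add.
Proof.
elim/lp_ind=> s; rewrite lp_scaleE lp_addE.
by apply/lp_classP; exact: lc_addN.
Qed.

HB.instance Definition _ :=
  GRing.isZmodule.Build lie_pres lp_addA lp_addC lp_add0 lp_addN.

Fact lp_scaleA a b x : lp_scale a (lp_scale b x) = lp_scale (a * b) x.
Proof.
elim/lp_ind: x => s; rewrite !lp_scaleE.
by apply/lp_classP; exact: lc_scaleA.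
Qed.

Fact lp_scale1 : left_id 1 lp_scale.
Proof.
by elim/lp_ind=> s; rewrite lp_scaleE; apply/lp_classP; exact: lc_scale1.
Qed.

Fact lp_scaleDr : right_distributive lp_scale +%R.
Proof.
move=> a; elim/lp_ind=> s; elim/lp_ind=> t.
rewrite /GRing.add /= !(lp_addE, lp_scaleE).
by apply/lp_classP; exact: lc_scaleDr.
Qed.

Fact lp_scaleDl x : {morph lp_scale^~ x : a b / a + b}.
Proof.
move=> a b; elim/lp_ind: x => s; rewrite {2}/GRing.add /= !(lp_scaleE, lp_addE).
by apply/lp_classP; exact: lc_scaleDl.
Qed.

HB.instance Definition _ := GRing.Zmodule_isLmodule.Build R lie_pres
  lp_scaleA lp_scale1 lp_scaleDr lp_scaleDl.

Lemma lp_class0 : lp_class LZero = 0. Proof. by []. Qed.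

Lemma lp_classD s t : lp_class (LAdd s t) = lp_class s + lp_class t.
Proof. by rewrite -lp_addE. Qed.

Lemma lp_classZ a s : lp_class (LScale a s) = a *: lp_class s.
Proof. by rewrite -lp_scaleE. Qed.

Fact lp_brackPl (a : R) (x y z : lie_pres) :
  lp_brack (a *: x + y) z = a *: lp_brack x z + lp_brack y z.
Proof.
elim/lp_ind: x => s; elim/lp_ind: y => t; elim/lp_ind: z => u.
rewrite -lp_classZ -lp_classD !lp_brackE -lp_classZ -lp_classD.
by apply/lp_classP; exact: lc_brackPl.
Qed.

Fact lp_brackPr (a : R) (x y z : lie_pres) :
  lp_brack z (a *: x + y) = a *: lp_brack z x + lp_brack z y.
Proof.
elim/lp_ind: x => s; elim/lp_ind: y => t; elim/lp_ind: z => u.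
rewrite -lp_classZ -lp_classD !lp_brackE -lp_classZ -lp_classD.
by apply/lp_classP; exact: lc_brackPr.
Qed.

Fact lp_brackxx (x : lie_pres) : lp_brack x x = 0.
Proof.
elim/lp_ind: x => s; rewrite lp_brackE -lp_class0.
by apply/lp_classP; exact: lc_brackxx.
Qed.

Fact lp_jacobi (x y z : lie_pres) :
  lp_brack x (lp_brack y z) + lp_brack y (lp_brack z x)
    + lp_brack z (lp_brack x y) = 0.
Proof.
elim/lp_ind: x => s; elim/lp_ind: y => t; elim/lp_ind: z => u.
rewrite !lp_brackE -!lp_classD -lp_class0.
by apply/lp_classP; exact: lc_jacobi.
Qed.

HB.instance Definition _ := Lmodule_isLieAlgebra.Build R lie_pres
  lp_brackPl lp_brackPr lp_brackxx lp_jacobi.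

Lemma lp_classB s t : lp_class (LBrack s t) = lieb (lp_class s) (lp_class t).
Proof. by rewrite -lp_brackE. Qed.

Definition lp_gen (i : I) : lie_pres := lp_class (LGen i).

Fixpoint leval (L : lieAlgType R) (g : I -> L) (t : lterm) : L :=
  match t with
  | LGen i => g i
  | LZero => 0
  | LAdd s u => leval g s + leval g u
  | LScale a s => a *: leval g s
  | LBrack s u => lieb (leval g s) (leval g u)
  end.

Lemma leval_gen t : leval lp_gen t = lp_class t.
Proof.
elim: t => [i||s IHs t IHt|a s IHs|s IHs t IHt] //=.
- by rewrite IHs IHt lp_classD.
- by rewrite IHs lp_classZ.
- by rewrite IHs IHt lp_classB.
Qed.

Lemma leval_cong (L : lieAlgType R) (g : I -> L) :
  (forall s t, r s t -> leval g s = leval g t) ->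
  forall s t, lcong r s t -> leval g s = leval g t.
Proof.
move=> hg s t; elim=> {s t} //=.
- by move=> s t u _ -> _ ->.
- by move=> s s' t t' _ -> _ ->.
- by move=> a s s' _ ->.
- by move=> s s' t t' _ -> _ ->.
- by move=> s t u; rewrite addrA.
- by move=> s t; rewrite addrC.
- by move=> s; rewrite add0r.
- by move=> s; rewrite scaleN1r addNr.
- by move=> a b s; rewrite scalerA.
- by move=> s; rewrite scale1r.
- by move=> a s t; rewrite scalerDr.
- by move=> s a b; rewrite scalerDl.
- by move=> a s t u; rewrite liebPl.
- by move=> a s t u; rewrite liebPr.
- by move=> s; rewrite liebxx.
- by move=> s t u; rewrite lieb_jacobi.
Qed.

Lemma lie_pres_rel s t : r s t -> leval lp_gen s = leval lp_gen t.
Proof. by move=> st; rewrite !leval_gen; apply/lp_classP; exact: lc_rel. Qed.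

Lemma lie_pres_univ (L : lieAlgType R) (g : I -> L) :
  (forall s t, r s t -> leval g s = leval g t) ->
  exists2 f : lie_pres -> L,
    is_lie_morphism f /\ (forall i, f (lp_gen i) = g i)
  & forall f' : lie_pres -> L,
      is_lie_morphism f' -> (forall i, f' (lp_gen i) = g i) -> f' =1 f.
Proof.
move=> hg; pose f (x : lie_pres) := leval g (lp_repr x).
have fE s : f (lp_class s) = leval g s by apply: leval_cong hg _ _ (lp_classK s).
exists f; first split; first split.
- by elim/lp_ind=> s; elim/lp_ind=> t; rewrite -lp_classD !fE.
- by move=> a; elim/lp_ind=> s; rewrite -lp_classZ !fE.
- by elim/lp_ind=> s; elim/lp_ind=> t; rewrite -lp_classB !fE.
- by move=> i; rewrite fE.
move=> f' [f'D f'Z f'B] f'g; elim/lp_ind=> t; rewrite fE.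
elim: t => [i||s IHs t IHt|a s IHs|s IHs t IHt] /=.
- exact: f'g.
- by rewrite lp_class0 -(scale0r 0) f'Z scale0r.
- by rewrite lp_classD f'D IHs IHt.
- by rewrite lp_classZ f'Z IHs.
- by rewrite lp_classB f'B IHs IHt.
Qed.

End Presentation.

Arguments LGen {R I} _.
Arguments LZero {R I}.
Arguments LAdd {R I} _ _.
Arguments LScale {R I} _ _.
Arguments LBrack {R I} _ _.

Section Electrical.
Variables (R : realType) (n : nat).

(* The generators e_1, ..., e_{2n} are indexed from 0; |i - j| is the distance
   of natural numbers. *)
Inductive el_rel : lterm R 'I_(2 * n) -> lterm R 'I_(2 * n) -> Prop :=
  | el_far (i j : 'I_(2 * n)) : (1 < `|i - j|)%N ->
      el_rel (LBrack (LGen i) (LGen j)) LZero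
  | el_near (i j : 'I_(2 * n)) : `|i - j|%N = 1%N ->
      el_rel (LBrack (LGen i) (LBrack (LGen i) (LGen j)))
             (LScale (- 2%:R) (LGen i)).

Definition el2n : lieAlgType R := lie_pres el_rel.

End Electrical.

Section Symplectic.
Variables (R : realType) (n : nat).

Definition sp_mx : {pred 'M[R]_(n + n)} := fun M =>
  [&& ulsubmx M == - (drsubmx M)^T, ursubmx M == (ursubmx M)^T
    & dlsubmx M == (dlsubmx M)^T].

Lemma sp_mxP (M : 'M[R]_(n + n)) :
  reflect [/\ ulsubmx M = - (drsubmx M)^T, ursubmx M = (ursubmx M)^T
            & dlsubmx M = (dlsubmx M)^T] (M \in sp_mx).
Proof.
apply: (iffP and3P) => -[] => [/eqP ? /eqP ? /eqP ? | -> h1 h2] //.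
by split=> //; apply/eqP.
Qed.

Fact sp_mx_submod_closed : submod_closed sp_mx.
Proof.
split=> [|a A B /sp_mxP [A1 A2 A3] /sp_mxP [B1 B2 B3]]; apply/sp_mxP.
  by split; apply/matrixP=> i j; rewrite !mxE ?oppr0.
have E (M N : 'M[R]_(n + n)) i j : (a *: M + N) i j = a * M i j + N i j.
  by rewrite !mxE.
split; apply/matrixP=> i j.
- move/matrixP/(_ i j): A1; move/matrixP/(_ i j): B1; rewrite !mxE => -> ->.
  by rewrite mulrN opprD.
- by move/matrixP/(_ i j): A2; move/matrixP/(_ i j): B2; rewrite !mxE => -> ->.
- by move/matrixP/(_ i j): A3; move/matrixP/(_ i j): B3; rewrite !mxE => -> ->.
Qed.

HB.instance Definition _ :=
  GRing.isSubmodClosed.Build R 'M[R]_(n + n) sp_mx sp_mx_submod_closed.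

Record sp2n := Sp2n { sp_val :> 'M[R]_(n + n); sp_valP : sp_val \in sp_mx }.

HB.instance Definition _ := [isSub for sp_val].
HB.instance Definition _ := [Choice of sp2n by <:].
HB.instance Definition _ := [SubChoice_isSubLmodule of sp2n by <:].

Fact sp_brack_subproof (A B : sp2n) :
  sp_val A *m sp_val B - sp_val B *m sp_val A \in sp_mx.
Proof.
case: A B => [A /= /sp_mxP [A1 A2 A3]] [B /= /sp_mxP [B1 B2 B3]].
apply/sp_mxP; rewrite -(submxK A) -(submxK B) A1 B1.
move: (ursubmx A) (dlsubmx A) (drsubmx A) A2 A3 => X Y Z X1 Y1.
move: (ursubmx B) (dlsubmx B) (drsubmx B) B2 B3 => X' Y' Z' X1' Y1'.
rewrite !mulmx_block opp_block_mx add_block_mx.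
rewrite block_mxKul block_mxKur block_mxKdl block_mxKdr.
rewrite !(raddfD, raddfN) /= !trmx_mul !raddfN /= !trmxK.
rewrite -X1 -Y1 -X1' -Y1' !(mulNmx, mulmxN, opprK, opprD).
split.
- move: (Z^T *m Z'^T) (X *m Y') (Z'^T *m Z^T) (X' *m Y) => P1 P2 P3 P4.
  by apply/matrixP=> i j; rewrite !mxE; ring.
- move: (Z^T *m X') (X *m Z') (Z'^T *m X) (X' *m Z) => P1 P2 P3 P4.
  by apply/matrixP=> i j; rewrite !mxE; ring.
- move: (Y *m Z'^T) (Z *m Y') (Y' *m Z^T) (Z' *m Y) => P1 P2 P3 P4.
  by apply/matrixP=> i j; rewrite !mxE; ring.
Qed.

Definition sp_brack (A B : sp2n) : sp2n := Sp2n (sp_brack_subproof A B).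

Fact sp_brackPl (a : R) (x y z : sp2n) :
  sp_brack (a *: x + y) z = a *: sp_brack x z + sp_brack y z.
Proof.
apply: val_inj => /=; rewrite mulmxDl mulmxDr -scalemxAl -scalemxAr scalerBr.
by rewrite opprD addrACA.
Qed.

Fact sp_brackPr (a : R) (x y z : sp2n) :
  sp_brack z (a *: x + y) = a *: sp_brack z x + sp_brack z y.
Proof.
apply: val_inj => /=; rewrite mulmxDl mulmxDr -scalemxAl -scalemxAr scalerBr.
by rewrite opprD addrACA.
Qed.

Fact sp_brackxx (x : sp2n) : sp_brack x x = 0.
Proof. by apply: val_inj => /=; rewrite subrr. Qed.

Fact sp_brack_jacobi (x y z : sp2n) :
  sp_brack x (sp_brack y z) + sp_brack y (sp_brack z x)
    + sp_brack z (sp_brack x y) = 0.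
Proof.
apply: val_inj => /=; rewrite !(mulmxBl, mulmxBr) !mulmxA.
case: x y z => [x _] [y _] [z _] /=.
move: (x *m y *m z) (x *m z *m y) (y *m x *m z) => P1 P2 P3.
move: (y *m z *m x) (z *m x *m y) (z *m y *m x) => P4 P5 P6.
by apply/matrixP=> i j; rewrite !mxE; ring.
Qed.

HB.instance Definition _ := Lmodule_isLieAlgebra.Build R sp2n
  sp_brackPl sp_brackPr sp_brackxx sp_brack_jacobi.

End Symplectic.

(* Main.v *)
Require Import Defs.
From HB Require Import structures.
From mathcomp Require Import all_boot all_order all_algebra.
From mathcomp Require Import boolp reals.
From mathcomp Require Import zify.

(** Let [v_0, ..., v_(2n-1)] be a basis of the symplectic space such that
    omega(v_i, v_(i+1)) = 1 and omega(v_i, v_j) = 0 for non-adjacent indices.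
    The Lie algebra sp_2n is the symmetric square of this space, a product [u v]
    being the endomorphism [w |-> omega(v, w) u + omega(u, w) v], and the
    endomorphisms [x_i = w |-> omega(v_i, w) v_i] satisfy [x_i, x_j] = 0 for
    non-adjacent indices and [x_i, [x_i, x_j]] = 2 x_i for adjacent ones.
    Therefore e_i |-> (-1)^i x_i respects the defining relations and induces a
    morphism [f] from el_2n to sp_2n.

    In el_2n, consider the chains, the nested brackets
    [e_i, [e_(i+1), ... e_j]] of consecutive generators, one for each i <= j.
    The bracket of a generator with a chain is a combination of chains
    ([chain_stable]): moving generators past those that commute with them reduces
    this to the defining relations and to the bracket of e_(i+1) with
    [e_i, [e_(i+1), e_(i+2)]], which is computed in [chain_middle].  As the chains
    include the generators, they span el_2n ([chain_comb_surj]).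

    Bracketing with x_i sends x_(i+1) to v_i v_(i+1), and it sends v_(i+1) v_j to
    v_i v_j for j > i+1.  So, up to sign, [f] sends the chain from i to j to x_i
    if i = j and to v_i v_j otherwise; these form a basis of the symmetric square.
    A linear map that sends a spanning family to a basis is bijective, so [f] is
    an isomorphism.

    Concretely, the path basis is a matrix [P] with [P^T *m omega *m P] equal to
    the path form, and the symmetric tensor with coordinates [T] is the matrix
    [P *m T *m P^T *m omega]. *)

Set Implicit Arguments.
Unset Strict Implicit.
Unset Printing Implicit Defensive.

Import GRing.Theory Num.Theory.
Local Open Scope ring_scope.

(** * Bracket identities *)

Section LieCalculus.
Variables (R : comNzRingType) (L : lieAlgType R).
Implicit Types (x y z : L) (a : R).

Lemma liebDl x y z : lieb (x + y) z = lieb x z + lieb y z.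
Proof. by rewrite -[x]scale1r liebPl !scale1r. Qed.

Lemma liebDr x y z : lieb z (x + y) = lieb z x + lieb z y.
Proof. by rewrite -[x]scale1r liebPr !scale1r. Qed.

Lemma lieb0l z : lieb 0 z = 0 :> L.
Proof. by apply: (addrI (lieb 0 z)); rewrite -liebDl !addr0. Qed.

Lemma lieb0r z : lieb z 0 = 0 :> L.
Proof. by apply: (addrI (lieb z 0)); rewrite -liebDr !addr0. Qed.

Lemma liebZl a x z : lieb (a *: x) z = a *: lieb x z.
Proof. by rewrite -[a *: x]addr0 liebPl lieb0l addr0. Qed.

Lemma liebZr a x z : lieb z (a *: x) = a *: lieb z x.
Proof. by rewrite -[a *: x]addr0 liebPr lieb0r addr0. Qed.

Lemma liebNr x z : lieb z (- x) = - lieb z x.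
Proof. by rewrite -!scaleN1r liebZr. Qed.

Lemma liebC x y : lieb x y = - lieb y x.
Proof.
by apply/eqP; rewrite -addr_eq0 -(liebxx (x + y)) liebDl !liebDr !liebxx
  add0r addr0.
Qed.

Lemma lieb_derivation x y z :
  lieb x (lieb y z) = lieb (lieb x y) z + lieb y (lieb x z).
Proof.
have := lieb_jacobi x y z.
rewrite (liebC z (lieb x y)) (liebC z x) liebNr => /eqP.
by rewrite subr_eq0 subr_eq => /eqP.
Qed.

Lemma lieb_comm x y z : lieb x y = 0 -> lieb x (lieb y z) = lieb y (lieb x z).
Proof. by move=> xy0; rewrite lieb_derivation xy0 lieb0l add0r. Qed.

End LieCalculus.

(** * Nested brackets of consecutive generators *)

Section Chains.
Variables (R : numFieldType) (L : lieAlgType R) (m : nat) (e : nat -> L).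

Hypothesis e_far : forall i j, (i.+1 < j)%N -> (j < m)%N ->
  lieb (e i) (e j) = 0.
Hypothesis e_up : forall i, (i.+1 < m)%N ->
  lieb (e i) (lieb (e i) (e i.+1)) = - 2%:R *: e i.
Hypothesis e_down : forall i, (i.+1 < m)%N ->
  lieb (e i.+1) (lieb (e i.+1) (e i)) = - 2%:R *: e i.+1.

(** [d] counts brackets, so that the letters are [e i], ..., [e (i + d)].  The
    family [e] is indexed by [nat] because shifting an index then needs no cast. *)
Fixpoint chain (i d : nat) : L :=
  if d is d'.+1 then lieb (e i) (chain i.+1 d') else e i.

Lemma e_far_sym i j : (i.+1 < j)%N -> (j < m)%N -> lieb (e j) (e i) = 0.
Proof. by move=> ij jm; rewrite liebC e_far ?oppr0. Qed.

Lemma chain_before d i k : (k.+1 < i)%N -> (i + d < m)%N ->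
  lieb (e k) (chain i d) = 0.
Proof.
elim: d i => [|d IH] i ki im /=; first by apply: e_far => //; lia.
rewrite lieb_comm; last by apply: e_far; lia.
by rewrite IH ?lieb0r //; lia.
Qed.

Lemma chain_after d i k : (i + d.+1 < k)%N -> (k < m)%N ->
  lieb (e k) (chain i d) = 0.
Proof.
elim: d i => [|d IH] i ik km /=; first by apply: e_far_sym => //; lia.
rewrite lieb_comm; last by apply: e_far_sym; lia.
by rewrite IH ?lieb0r //; lia.
Qed.

(** A chain can also be lengthened on its right: the new generator commutes with
    all but the last letter, so it moves through the nested brackets and reaches
    the innermost one.  This left-right symmetry drives the next lemmas: an
    operator acting at one end of a chain commutes with the letters added at the
    other end. *)
Lemma chain_extendr d i : (i + d.+1 < m)%N ->
  lieb (e (i + d.+1)) (chain i d) = - chain i d.+1.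
Proof.
elim: d i => [|d IH] i im; first by rewrite /= addn1 liebC.
rewrite [chain i d.+1]/= lieb_comm; last by apply: e_far_sym; lia.
by rewrite addnS -addSn IH ?liebNr //; lia.
Qed.

Lemma chain_first d i : (i + d.+2 < m)%N ->
  lieb (e i) (chain i d.+2) = 0.
Proof.
elim: d => [|d IH] im; rewrite -[chain i _]opprK -chain_extendr // liebNr.
  rewrite lieb_comm ?e_far //; last by lia.
  by rewrite [chain i 1]/= e_up ?liebZr ?e_far_sym ?scaler0 ?oppr0 //; lia.
by rewrite lieb_comm ?e_far ?IH ?lieb0r ?oppr0 //; lia.
Qed.

Lemma chain_last1 i : (i.+1 < m)%N ->
  lieb (e i.+1) (chain i 1) = 2%:R *: e i.+1.
Proof.
by move=> im; rewrite /= (liebC (e i)) liebNr e_down // scaleNr opprK.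
Qed.

Lemma chain_last d i : (i + d.+2 < m)%N ->
  lieb (e (i + d.+2)) (chain i d.+2) = 0.
Proof.
elim: d i => [|d IH] i im; rewrite [chain i _]/= -/(chain i.+1 _) lieb_comm;
  try by apply: e_far_sym; lia.
  rewrite addn2 chain_last1; last by lia.
  by rewrite liebZr e_far ?scaler0 //; lia.
by rewrite addnS -addSn IH ?lieb0r //; lia.
Qed.

(** The only case that does not follow by moving commuting generators past each
    other: here a generator meets both of its neighbours. *)
Lemma chain_middle i : (i.+2 < m)%N ->
  lieb (e i.+1) (chain i 2) = chain i.+1 1 - chain i 1.
Proof.
move=> im; rewrite /=.
set a := e i; set b := e i.+1; set c := e i.+2.
have bba : lieb b (lieb b a) = - 2%:R *: b by apply: e_down; lia.
have bbc : lieb b (lieb b c) = - 2%:R *: b by apply: e_up.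
have ac : lieb a c = 0 by apply: e_far.
(* Leibniz' rule for the square of [lieb b], applied to the vanishing bracket of
   [a] and [c], gives twice the crossed bracket: 2 has to be cancelled. *)
have crossed : lieb (lieb b a) (lieb b c) = lieb b c + lieb a b.
  have := congr1 (fun x => lieb b (lieb b x)) ac.
  rewrite !lieb0r (lieb_derivation b a c) liebDr !(lieb_derivation b (lieb _ _)).
  rewrite (lieb_derivation b a (lieb b c)) bba bbc !liebZl liebZr => /eqP.
  set X := lieb (lieb b a) (lieb b c); set Y := lieb b c; set Z := lieb a b.
  rewrite -addrA (addrA X) -mulr2n -scaler_nat addrCA -[X in X == _]addrC.
  rewrite -scalerDr scaleNr addrC subr_eq0 => /eqP; apply: scalerI.
  by rewrite pnatr_eq0.
rewrite (lieb_derivation b a) crossed bbc liebZr scaleNr scaler_nat mulr2n.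
by rewrite opprD !addrA addrK.
Qed.

Lemma chain_second d i : (i + d.+3 < m)%N ->
  lieb (e i.+1) (chain i d.+3) = chain i.+1 d.+2.
Proof.
elim: d => [|d IH] im; rewrite -[chain i _]opprK -chain_extendr // liebNr
    lieb_comm; try by apply: e_far; lia.
  rewrite chain_middle; last by lia.
  rewrite liebDr liebNr (chain_after (i := i) (d := 1)); try by lia.
  by rewrite addnS -addSn chain_extendr ?subr0 ?opprK //; lia.
rewrite IH; last by lia.
by rewrite addnS -addSn chain_extendr ?opprK //; lia.
Qed.

Lemma chain_penultimate d i : (i + d.+3 < m)%N ->
  lieb (e (i + d.+2)) (chain i d.+3) = - chain i d.+2.
Proof.
elim: d i => [|d IH] i im; rewrite [chain i _]/= -/(chain i.+1 _) lieb_comm;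
  try by apply: e_far_sym; lia.
  rewrite addn2 (chain_middle (i := i.+1)); last by lia.
  by rewrite liebDr liebNr chain_before ?sub0r //; lia.
by rewrite addnS -addSn (IH i.+1) ?liebNr //; lia.
Qed.

Lemma chain_inner d i k : (i.+1 < k)%N -> (k.+1 < i + d)%N -> (i + d < m)%N ->
  lieb (e k) (chain i d) = 0.
Proof.
elim: d i => [|d IH] i ik kid im; first by lia.
rewrite /= lieb_comm; last by apply: e_far_sym; lia.
have [ik2|ik2] := ltnP i.+2 k; first by rewrite IH ?lieb0r //; lia.
have -> : k = i.+2 by lia.
case: d IH kid im => [|[|[|d]]] IH kid im; try by lia.
by rewrite (chain_second (i := i.+1)) ?chain_before //; lia.
Qed.

(** The previous lemmas express every bracket of a generator with a chain as a
    combination of at most two chains, so the span of the chains is stable under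
    the generators. *)
Lemma chain_stable (S : L -> Prop) :
  S 0 -> (forall a x, S x -> S (a *: x)) ->
  (forall x y, S x -> S y -> S (x + y)) ->
  (forall i d, (i + d < m)%N -> S (chain i d)) ->
  forall k i d, (k < m)%N -> (i + d < m)%N -> S (lieb (e k) (chain i d)).
Proof.
move=> S0 SZ SD Sc k i d km im.
have SN x : S x -> S (- x) by rewrite -scaleN1r; exact: SZ.
have [ki|ki] := ltnP k i.
  have [->|?] := eqVneq i k.+1; first by rewrite -/(chain k d.+1); apply: Sc; lia.
  by rewrite chain_before //; lia.
have [ki'|ki'] := ltnP (i + d) k.
  have [->|?] := eqVneq k (i + d.+1); last by rewrite chain_after //; lia.
  by rewrite chain_extendr; [apply/SN/Sc|]; lia.
have [->{k km ki ki'}|kNi] := eqVneq k i.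
  case: d im => [|[|d]] im; first by rewrite liebxx.
    by rewrite /= e_up; [apply/SZ/(Sc i 0%N)|]; lia.
  by rewrite chain_first.
have [->{k km ki ki' kNi}|kNid] := eqVneq k (i + d)%N.
  case: d im => [|[|d]] im; first by rewrite addn0 liebxx.
    by rewrite addn1 chain_last1; [apply/SZ/(Sc i.+1 0%N)|]; lia.
  by rewrite chain_last.
have [ki1|kNi1] := eqVneq k i.+1.
  rewrite ki1 in ki' kNid *.
  case: d im ki' kNid => [|[|[|d]]] im ki' kNid; try by lia.
    by rewrite chain_middle; [apply: SD; [|apply: SN]; apply: Sc|]; lia.
  by rewrite chain_second; [apply: Sc|]; lia.
case: d im ki' kNid => [|[|[|d]]] im ki' kNid; try by lia.
have [->|kNid1] := eqVneq k (i + d.+2)%N.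
  by rewrite chain_penultimate; [apply/SN/Sc|]; lia.
by rewrite chain_inner //; lia.
Qed.

End Chains.

(** * The symplectic form and its path basis *)

Section SymplecticForm.
Variables (R : comNzRingType) (n : nat).

(** The standard symplectic form of the space of pairs of vectors. *)
Definition omega : 'M[R]_(n + n) := block_mx 0 1%:M (- 1%:M) 0.

Lemma omega_sqr : omega *m omega = - 1%:M.
Proof.
rewrite (scalar_mx_block n n) opp_block_mx oppr0 mulmx_block.
by rewrite !mul0mx !mulmx0 !add0r !addr0 mulmx1 mul1mx.
Qed.

End SymplecticForm.

Section SymplecticAlgebra.
Variables (R : realType) (n : nat).
Local Notation omega := (omega R n).

(** In block form, [S *m omega] turns the three block conditions that define
    sp_2n into the symmetry of [S]; [sp_omega_sym] is the converse, because
    [omega] squares to -1. *)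
Lemma sym_omega_sp (S : 'M[R]_(n + n)) : S^T = S -> S *m omega \in sp_mx (n:=n).
Proof.
rewrite -(submxK S) tr_block_mx => /eq_block_mx [Sul Sdl _ Sdr].
rewrite mulmx_block !mulmx0 !mulmxN !mulmx1 !add0r !addr0.
apply/sp_mxP; rewrite block_mxKul block_mxKur block_mxKdl block_mxKdr.
by rewrite Sul Sdl raddfN /= Sdr.
Qed.

Lemma sp_omega_sym (M : 'M[R]_(n + n)) :
  M \in sp_mx (n:=n) -> (M *m omega)^T = M *m omega.
Proof.
case/sp_mxP => Mul Mur Mdl; rewrite -(submxK M).
rewrite mulmx_block !mulmx0 !mulmxN !mulmx1 !add0r !addr0 tr_block_mx.
by rewrite !raddfN /= -Mur -Mdl Mul raddfN /= trmxK.
Qed.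

End SymplecticAlgebra.

Section PathForm.
Variables (R : comNzRingType).

(** The Gram matrix of a family of vectors, each pairing to 1 with the next one
    and to 0 with those further away. *)
Definition path_form m : 'M[R]_m :=
  \matrix_(i, j) ((j == i.+1 :> nat)%:R - (i == j.+1 :> nat)%:R).

Lemma path_form_antisym m (i j : 'I_m) : path_form m j i = - path_form m i j.
Proof. by rewrite !mxE opprB. Qed.

End PathForm.

Section PathBasis.
Variables (R : comNzRingType) (n : nat).

(** The columns form a basis of the symplectic space whose Gram matrix is the
    path form.  With a Darboux basis [a_k, b_k], column [2k] is [a_k] and column
    [2k+1] is [b_k - b_(k+1)], where [b_n] stands for 0: each difference has
    opposite pairings with its two neighbours [a_k] and [a_(k+1)]. *)
Definition path_basis : 'M[R]_(n + n, 2 * n) :=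
  col_mx (\matrix_(k, i) (i == k.*2 :> nat)%:R)
         (\matrix_(k, i) ((i == k.*2.+1 :> nat)%:R - (i.+1 == k.*2 :> nat)%:R)).

(** The telescoping sum of the columns [2l+1] for [l >= k] recovers [b_k]. *)
Definition path_basis_inv : 'M[R]_(2 * n, n + n) :=
  row_mx (\matrix_(i, k) (i == k.*2 :> nat)%:R)
         (\matrix_(i, k) (odd i && (k.*2 < i)%N)%:R).

Lemma sum_pick (m p : nat) (F : nat -> R) : (p < m)%N ->
  \sum_(i < m) (i == p :> nat)%:R * F i = F p.
Proof.
move=> pm; rewrite (bigD1 (Ordinal pm)) //= eqxx mul1r big1 ?addr0 // => i.
by rewrite -val_eqE /= => /negPf ->; rewrite mul0r.
Qed.

Lemma sum_pick_pred (m p : nat) (F : nat -> R) : (p <= m)%N ->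
  \sum_(i < m) (i.+1 == p)%:R * F i = (0 < p)%:R * F p.-1.
Proof.
case: p => [|p] pm; first by rewrite big1 ?mul0r // => i _; rewrite mul0r.
by under eq_bigr do rewrite eqSS; rewrite sum_pick ?mul1r.
Qed.

Lemma path_basisK : path_basis *m path_basis_inv = 1%:M.
Proof.
have le_double (k : 'I_n) : (k.*2.+1 < 2 * n)%N by have := ltn_ord k; lia.
rewrite mul_col_row scalar_mx_block; congr block_mx; apply/matrixP => k l;
  rewrite !mxE; have := le_double k => km; under eq_bigr do rewrite !mxE ?mulrBl.
- by rewrite (sum_pick (fun i => (i == l.*2)%:R)) ?(inj_eq double_inj) //; lia.
- by rewrite (sum_pick (fun i => (odd i && (l.*2 < i)%N)%:R)) ?odd_double //; lia.
- rewrite sumrB (sum_pick (fun i => (i == l.*2)%:R)) //.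
  rewrite (sum_pick_pred (fun i => (i == l.*2)%:R)); last by lia.
  have -> : (k.*2.+1 == l.*2) = false by lia.
  have [->|k0] := posnP k; first by rewrite mul0r subr0.
  have -> : (k.*2.-1 == l.*2) = false by lia.
  by rewrite mulr0 subr0.
rewrite sumrB (sum_pick (fun i => (odd i && (l.*2 < i)%N)%:R)) //.
rewrite (sum_pick_pred (fun i => (odd i && (l.*2 < i)%N)%:R)); last by lia.
rewrite -natrM mulnb -[k == l]/(k == l :> nat).
have -> : odd k.*2.+1 && (l.*2 < k.*2.+1)%N = (l <= k)%N by lia.
have -> : (0 < k.*2)%N && (odd k.*2.-1 && (l.*2 < k.*2.-1)%N) = (l < k)%N by lia.
by case: ltngtP => _; rewrite ?subrr ?subr0.
Qed.

Lemma path_basis_form :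
  path_basis^T *m omega R n *m path_basis = path_form R (2 * n).
Proof.
(* Column [i] of the upper block is nonzero only at [k = i/2], for [i] even; hence
   exactly one of the two halves of the form contributes at adjacent indices. *)
have pick (i : 'I_(2 * n)) (F : nat -> R) :
    \sum_(k < n) (i == k.*2 :> nat)%:R * F k = (~~ odd i)%:R * F i./2.
  have i2 : (i./2 < n)%N by have := ltn_ord i; lia.
  have [oi|ei] := boolP (odd i) => /=.
    rewrite mul0r big1 // => k _; have -> : (i == k.*2 :> nat) = false by lia.
    by rewrite mul0r.
  rewrite mul1r -(sum_pick F i2); apply: eq_bigr => k _.
  by congr (_%:R * _); lia.
apply/matrixP => i j.
rewrite tr_col_mx mul_row_block !mulmx0 mulmxN !mulmx1 add0r addr0 mul_row_col.
rewrite addrC mulNmx !mxE.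
under eq_bigr do rewrite !mxE.
under [X in _ - X]eq_bigr do rewrite !mxE mulrC.
rewrite (pick i (fun k => (j == k.*2.+1 :> nat)%:R - (j.+1 == k.*2 :> nat)%:R)).
rewrite (pick j (fun k => (i == k.*2.+1 :> nat)%:R - (i.+1 == k.*2 :> nat)%:R)).
have [oi|ei] := boolP (odd i); have [oj|ej] := boolP (odd j);
  rewrite ?mul0r ?mul1r ?subr0 ?sub0r ?opprB.
- have -> : (j == i.+1 :> nat) = false by lia.
  have -> : (i == j.+1 :> nat) = false by lia.
  by rewrite subrr.
- by congr (_%:R - _%:R); lia.
- by congr (_%:R - _%:R); lia.
have -> : (j == i.+1 :> nat) = false by lia.
have -> : (i == j.+1 :> nat) = false by lia.
have -> : (j == i./2.*2.+1 :> nat) = false by lia.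
have -> : (i == j./2.*2.+1 :> nat) = false by lia.
have -> : (j.+1 == i./2.*2 :> nat) = false by lia.
have -> : (i.+1 == j./2.*2 :> nat) = false by lia.
by rewrite !subrr addr0.
Qed.

Lemma path_basis_invK : path_basis_inv *m path_basis = 1%:M.
Proof.
(* The two dimensions [2 * n] and [n + n] are equal but not convertible. *)
have sq m p (A : 'M[R]_(m, p)) B : m = p -> A *m B = 1%:M -> B *m A = 1%:M.
  by move=> mp; case: p / mp A B => A B; exact: mulmx1C.
by apply: sq path_basisK; lia.
Qed.

End PathBasis.

(** * Symmetric matrices with the commutator of a bilinear form *)

Section FormCommutator.
Variables (R : comNzRingType) (m : nat) (K : 'M[R]_m).

(** The commutator that symmetric matrices [A] inherit from the endomorphisms
    [A *m K], whose products are [A *m K *m B *m K]. *)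
Definition form_comm (A B : 'M[R]_m) := A *m K *m B - B *m K *m A.

Lemma form_commZr a A B : form_comm A (a *: B) = a *: form_comm A B.
Proof. by rewrite /form_comm -scalemxAr -!scalemxAl -scalerBr. Qed.

(** The matrix of the product [v_i v_j] in the symmetric square; on the diagonal
    it is twice the matrix unit, which keeps [form_comm_sym_unit] free of case
    distinctions. *)
Definition sym_unit (i j : 'I_m) : 'M[R]_m := delta_mx i j + delta_mx j i.

Lemma delta_form_delta (i j k l : 'I_m) :
  delta_mx i j *m K *m delta_mx k l = K j k *: delta_mx i l.
Proof.
apply/matrixP => a b; rewrite !mxE (bigD1 k) //= !mxE eqxx andTb.
rewrite (bigD1 j) //= !mxE eqxx andbT !big1 ?addr0.
- by case: (a == i); case: (b == l); rewrite ?(mul0r, mulr0, mul1r, mulr1).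
- by move=> c /negPf cj; rewrite !mxE cj /= ?andbF ?mul0r ?mulr0.
- by move=> c /negPf ck; rewrite !mxE ck /= ?andbF ?mul0r ?mulr0.
Qed.

Hypothesis K_antisym : forall i j, K j i = - K i j.

Lemma form_comm_square i j :
  form_comm (delta_mx i i) (delta_mx j j) = K i j *: sym_unit i j.
Proof.
by rewrite /form_comm !delta_form_delta (K_antisym i j) scaleNr opprK -scalerDr.
Qed.

(** The square of [v_i] acts on the symmetric square as the derivation that
    sends each [v_j] to [K i j *: v_i]. *)
Lemma form_comm_sym_unit i j k :
  form_comm (delta_mx i i) (sym_unit j k) =
  K i j *: sym_unit i k + K i k *: sym_unit i j.
Proof.
rewrite /form_comm /sym_unit mulmxDr !mulmxDl !delta_form_delta.
rewrite (K_antisym i j) (K_antisym i k) !scaleNr opprD !opprK !scalerDr.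
by rewrite [X in _ + X = _]addrC addrACA.
Qed.

End FormCommutator.

Section Symmetrization.
Variables (R : comNzRingType) (m : nat).

(** The pairs [i <= j] index the chains, and the entries at these pairs are
    independent coordinates of a symmetric matrix. *)
Definition symmetrize (T : 'M[R]_m) : 'M[R]_m :=
  \matrix_(i, j) if (i <= j)%N then T i j else T j i.

Lemma symmetrize_sym T : (symmetrize T)^T = symmetrize T.
Proof.
by apply/matrixP => i j; rewrite !mxE; case: ltngtP => // /val_inj ->.
Qed.

Lemma symmetrize_id T : T^T = T -> symmetrize T = T.
Proof.
move=> sT; apply/matrixP => i j; rewrite !mxE; case: ifP => // _.
by rewrite -{1}sT mxE.
Qed.

Lemma symmetrize_sum (T : 'M[R]_m) :
  symmetrize T =
  \sum_(i < m) \sum_(j < m | (i <= j)%N) T i j *: symmetrize (delta_mx i j).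
Proof.
have upper (a b : 'I_m) : (a <= b)%N ->
    (\sum_(i < m) \sum_(j < m | (i <= j)%N) T i j *: symmetrize (delta_mx i j)) a b
    = T a b.
  move=> ab; rewrite summxE (bigD1 a) //= summxE (bigD1 b) //= !mxE ab !eqxx mulr1.
  rewrite !big1 ?addr0 // => i.
    move=> /negPf ia; rewrite summxE big1 // => j _; rewrite !mxE ab.
    by rewrite eq_sym ia mulr0.
  by case/andP=> _ /negPf ib; rewrite !mxE ab [b == i]eq_sym ib andbF mulr0.
apply/matrixP => i j; rewrite mxE; case: leqP => [ij|/ltnW ji].
  by rewrite upper.
rewrite -[RHS]/(_ i j) -(upper j i) // !summxE; apply: eq_bigr => a _.
rewrite !summxE; apply: eq_bigr => b _.
by rewrite -{2}symmetrize_sym !mxE.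
Qed.

Lemma symmetrize_delta_diag i : symmetrize (delta_mx i i) = delta_mx i i.
Proof. by rewrite symmetrize_id ?trmx_delta. Qed.

Lemma symmetrize_delta (i j : 'I_m) :
  (i < j)%N -> symmetrize (delta_mx i j) = sym_unit R i j.
Proof.
move=> ij; apply/matrixP => a b; rewrite !mxE -!val_eqE /=.
case: leqP => ab.
  have -> : (a == j :> nat) && (b == i :> nat) = false by lia.
  by rewrite addr0.
have -> : (a == i :> nat) && (b == j :> nat) = false by lia.
by rewrite add0r andbC.
Qed.

End Symmetrization.

Section Congruence.
Variables (R : realType) (n : nat).
Local Notation P := (path_basis R n).
Local Notation Q := (path_basis_inv R n).
Local Notation Omega := (omega R n).
Local Notation K := (path_form R (2 * n)).

(** The endomorphism attached to the symmetric tensor with coordinates [T] in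
    the path basis; for [T = delta_mx i i] it is [w |-> omega(v_i, w) v_i]. *)
Definition sp_of_form (T : 'M[R]_(2 * n)) : 'M[R]_(n + n) :=
  P *m T *m P^T *m Omega.

Fact sp_of_form_linear : linear sp_of_form.
Proof.
by move=> a A B; rewrite /sp_of_form mulmxDr !mulmxDl -scalemxAr -!scalemxAl.
Qed.

HB.instance Definition _ :=
  GRing.isLinear.Build R _ _ _ sp_of_form sp_of_form_linear.

Lemma sp_of_formZ a T : sp_of_form (a *: T) = a *: sp_of_form T.
Proof. exact: linearZ. Qed.

Lemma sp_of_form_commutator A B :
  sp_of_form A *m sp_of_form B - sp_of_form B *m sp_of_form A =
  sp_of_form (form_comm K A B).
Proof.
rewrite /form_comm raddfB /=.
have E X Y : sp_of_form X *m sp_of_form Y = sp_of_form (X *m K *m Y).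
  by rewrite -path_basis_form /sp_of_form !mulmxA.
by rewrite !E.
Qed.

Lemma sp_of_form_sp T : T^T = T -> sp_of_form T \in sp_mx (n:=n).
Proof.
by move=> sT; apply: sym_omega_sp; rewrite !trmx_mul trmxK sT mulmxA.
Qed.

Lemma sp_of_form_inj : injective sp_of_form.
Proof.
move=> A B /(congr1 (fun X => - (Q *m (X *m Omega) *m Q^T))).
have PQt : P^T *m Q^T = 1%:M by rewrite -trmx_mul path_basis_invK trmx1.
have E X : - (Q *m (sp_of_form X *m Omega) *m Q^T) = X.
  rewrite /sp_of_form -(mulmxA _ Omega) omega_sqr mulmxN mulmx1 mulmxN mulNmx opprK.
  by rewrite !mulmxA path_basis_invK mul1mx -mulmxA PQt mulmx1.
by rewrite !E.
Qed.

(** Symmetric tensors exhaust sp_2n: [M *m omega] is symmetric, and its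
    coordinates in the path basis are obtained with the inverse of the basis. *)
Lemma sp_of_form_surj M : M \in sp_mx (n:=n) ->
  exists2 T, T^T = T & sp_of_form T = M.
Proof.
move=> /sp_omega_sym sM; exists (- (Q *m (M *m Omega) *m Q^T)).
  by rewrite raddfN /= !trmx_mul trmxK -[in LHS]trmx_mul sM mulmxA.
have QPt : Q^T *m P^T = 1%:M by rewrite -trmx_mul path_basisK trmx1.
rewrite /sp_of_form mulmxN !mulNmx !mulmxA path_basisK mul1mx.
by rewrite -(mulmxA _ Q^T) QPt mulmx1 -mulmxA omega_sqr mulmxN mulmx1 opprK.
Qed.

End Congruence.

(** * Chains span the electrical Lie algebra *)

Section Generation.
Variables (R : comNzRingType) (I : Type) (r : lterm R I -> lterm R I -> Prop).

(** A subspace that contains the generators and is stable under bracketing with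
    them is everything: the elements whose adjoint action preserves it form a
    Lie subalgebra by the Jacobi identity, so they include all elements. *)
Lemma lie_pres_generated (S : lie_pres r -> Prop) :
  S 0 -> (forall a x, S x -> S (a *: x)) ->
  (forall x y, S x -> S y -> S (x + y)) ->
  (forall i, S (lp_gen r i)) ->
  (forall i x, S x -> S (lieb (lp_gen r i) x)) -> forall x, S x.
Proof.
move=> S0 SZ SD Sg Sad.
have Sbrack t : forall x, S x -> S (lieb (lp_class r t) x).
  elim: t => [i||s IHs t IHt|a s IHs|s IHs t IHt] x Sx; first exact: Sad.
  - by rewrite lp_class0 lieb0l.
  - by rewrite lp_classD liebDl; apply: SD; [exact: IHs | exact: IHt].
  - by rewrite lp_classZ liebZl; apply/SZ/IHs.
  rewrite lp_classB.
  have -> : lieb (lieb (lp_class r s) (lp_class r t)) x =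
            lieb (lp_class r s) (lieb (lp_class r t) x) +
            -1 *: lieb (lp_class r t) (lieb (lp_class r s) x).
    by rewrite (lieb_derivation (lp_class r s)) scaleN1r addrK.
  by apply: SD; [|apply: SZ]; [apply/IHs/IHt | apply/IHt/IHs].
elim/lp_ind; elim=> [i||s IHs t IHt|a s IHs|s IHs t IHt]; first exact: Sg.
- by rewrite lp_class0.
- by rewrite lp_classD; apply: SD.
- by rewrite lp_classZ; apply: SZ.
- by rewrite lp_classB; apply: Sbrack.
Qed.

End Generation.

Section ElectricalChains.
Variables (R : realType) (n : nat).

Definition el_gen (k : nat) : el2n R n :=
  if insub k is Some i then lp_gen (@el_rel R n) i else 0.

Lemma el_gen_ord (i : 'I_(2 * n)) : el_gen i = lp_gen (@el_rel R n) i.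
Proof. by rewrite /el_gen valK. Qed.

Lemma el_gen_far i j : (i.+1 < j)%N -> (j < 2 * n)%N ->
  lieb (el_gen i) (el_gen j) = 0.
Proof.
move=> ij jm; have im : (i < 2 * n)%N by lia.
rewrite (el_gen_ord (Ordinal im)) (el_gen_ord (Ordinal jm)).
have far : (1 < `|Ordinal im - Ordinal jm|)%N by rewrite /=; lia.
exact: lie_pres_rel (el_far R far).
Qed.

Lemma el_gen_near i j : (i < 2 * n)%N -> (j < 2 * n)%N -> j = i.+1 \/ i = j.+1 ->
  lieb (el_gen i) (lieb (el_gen i) (el_gen j)) = - 2%:R *: el_gen i.
Proof.
move=> im jm ij.
rewrite (el_gen_ord (Ordinal im)) (el_gen_ord (Ordinal jm)).
have near : `|Ordinal im - Ordinal jm|%N = 1%N by rewrite /=; lia.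
exact: lie_pres_rel (el_near R near).
Qed.

(** The product of [(-1) ^+ k] over the letters of the chain, that is, the sign
    with which the comparison map sends the chain to a symmetric tensor. *)
Fixpoint chain_sign (i d : nat) : R :=
  (-1) ^+ i * (if d is d'.+1 then chain_sign i.+1 d' else 1).

Lemma chain_sign_sqr i d : chain_sign i d * chain_sign i d = 1.
Proof.
elim: d i => [|d IH] i /=; first by rewrite mulr1 -expr2 sqrr_sign.
by rewrite mulrACA IH mulr1 -expr2 sqrr_sign.
Qed.

(** The sign makes the comparison map send [chain_comb T] to the tensor with
    coordinates [symmetrize T].  All square matrices are allowed, although only
    the upper triangle matters, because they form a ready-made module. *)
Definition chain_comb (T : 'M[R]_(2 * n)) : el2n R n :=
  \sum_(i < 2 * n) \sum_(j < 2 * n | (i <= j)%N)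
    (chain_sign i (j - i) * T i j) *: chain el_gen i (j - i).

Fact chain_comb_linear : linear chain_comb.
Proof.
move=> a A B; rewrite /chain_comb scaler_sumr -big_split; apply: eq_bigr => i _.
rewrite scaler_sumr -big_split; apply: eq_bigr => j _ /=.
by rewrite !mxE mulrDr scalerDl scalerA mulrCA.
Qed.

HB.instance Definition _ :=
  GRing.isLinear.Build R _ _ _ chain_comb chain_comb_linear.

Lemma chain_comb_delta (i j : 'I_(2 * n)) : (i <= j)%N ->
  chain_comb (chain_sign i (j - i) *: delta_mx i j) = chain el_gen i (j - i).
Proof.
move=> ij; rewrite /chain_comb (bigD1 i) //= (bigD1 j) //= !mxE !eqxx mulr1.
rewrite chain_sign_sqr scale1r !big1 ?addr0 // => [k /negPf ki | k /andP[_ /negPf kj]].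
  by rewrite big1 // => l _; rewrite !mxE ki !mulr0 scale0r.
by rewrite !mxE kj andbF !mulr0 scale0r.
Qed.

Lemma chain_comb_surj (x : el2n R n) : exists T, x = chain_comb T.
Proof.
pose S (x : el2n R n) := exists T, x = chain_comb T.
have S0 : S 0 by exists 0; rewrite raddf0.
have SZ a y : S y -> S (a *: y) by case=> T ->; exists (a *: T); rewrite linearZ.
have SD y z : S y -> S z -> S (y + z).
  by case=> T -> [U ->]; exists (T + U); rewrite raddfD.
have Schain i d : (i + d < 2 * n)%N -> S (chain el_gen i d).
  move=> im; have im' : (i < 2 * n)%N by lia.
  exists (chain_sign i d *: delta_mx (Ordinal im') (Ordinal im)).
  have /= := @chain_comb_delta (Ordinal im') (Ordinal im) (leq_addr d i).
  by rewrite addKn => ->.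
have Sgen (i : 'I_(2 * n)) : S (lp_gen (@el_rel R n) i).
  by rewrite -el_gen_ord; apply: (Schain i 0%N); rewrite addn0.
move: x; apply: (lie_pres_generated (S := S)) => // i _ [T ->].
rewrite -el_gen_ord /chain_comb.
rewrite (big_morph (lieb (el_gen i)) (fun y z => liebDr y z _) (lieb0r _)).
apply: big_ind => // k _.
rewrite (big_morph (lieb (el_gen i)) (fun y z => liebDr y z _) (lieb0r _)).
apply: big_ind => // l kl; rewrite liebZr; apply: (SZ).
apply: (chain_stable el_gen_far _ _ S0 SZ SD Schain) => //; last by rewrite subnKC.
  by move=> j jm; apply: el_gen_near; lia.
by move=> j jm; apply: el_gen_near; lia.
Qed.

End ElectricalChains.

(** * The comparison map *)

Section Comparison.
Variables (R : realType) (n : nat).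
Local Notation K := (path_form R (2 * n)).

Definition sp_square (i : 'I_(2 * n)) : sp2n R n :=
  Sp2n (sp_of_form_sp (trmx_delta R i i)).

(** The alternating signs correct the sign of [sp_square_comm2], where the
    coefficient is +2 for adjacent indices instead of -2. *)
Definition sp_gen (i : 'I_(2 * n)) : sp2n R n := (-1) ^+ i *: sp_square i.

Lemma sp_val_inj : injective (@sp_val R n).
Proof. exact: val_inj. Qed.

Lemma sp_valB (A B : sp2n R n) :
  sp_val (lieb A B) = sp_val A *m sp_val B - sp_val B *m sp_val A.
Proof. by []. Qed.

Lemma sp_valZ a (A : sp2n R n) : sp_val (a *: A) = a *: sp_val A.
Proof. by []. Qed.

Lemma sp_lieb_of_form (A B : sp2n R n) T U :
  sp_val A = sp_of_form T -> sp_val B = sp_of_form U ->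
  sp_val (lieb A B) = sp_of_form (form_comm K T U).
Proof. by move=> AT BU; rewrite sp_valB AT BU sp_of_form_commutator. Qed.

Lemma sp_squareE i : sp_val (sp_square i) = sp_of_form (delta_mx i i).
Proof. by []. Qed.

Lemma sp_square_comm i j :
  sp_val (lieb (sp_square i) (sp_square j)) = sp_of_form (K i j *: sym_unit R i j).
Proof.
rewrite (sp_lieb_of_form (sp_squareE i) (sp_squareE j)).
by rewrite form_comm_square //; exact: path_form_antisym.
Qed.

Lemma sp_square_comm2 i j :
  lieb (sp_square i) (lieb (sp_square i) (sp_square j)) =
  (2%:R * K i j ^+ 2) *: sp_square i.
Proof.
apply: sp_val_inj; rewrite (sp_lieb_of_form (sp_squareE i) (sp_square_comm i j)).
rewrite form_commZr form_comm_sym_unit; last exact: path_form_antisym.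
have -> : K i i = 0 by rewrite mxE subrr.
rewrite scale0r add0r /sym_unit -mulr2n -scaler_nat !scalerA -expr2 mulrC.
exact: sp_of_formZ.
Qed.

Lemma path_form_far (i j : 'I_(2 * n)) : (1 < `|i - j|)%N -> K i j = 0.
Proof.
move=> ij; rewrite mxE; have -> : (j == i.+1 :> nat) = false by lia.
by have -> : (i == j.+1 :> nat) = false; [lia | rewrite subrr].
Qed.

Lemma path_form_near (i j : 'I_(2 * n)) : `|i - j|%N = 1%N -> K i j ^+ 2 = 1.
Proof.
move=> ij; rewrite mxE; have [ji|ji] := eqVneq (j : nat) i.+1.
  have -> : (i == j.+1 :> nat) = false by lia.
  by rewrite subr0 expr1n.
have -> : (i == j.+1 :> nat) by lia.
by rewrite sub0r sqrrN expr1n.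
Qed.

(** The inductive step that sends chains to the products [v_i v_j]: in the
    derivation by the square of [v_i], only the factor [v_(i+1)] contributes. *)
Lemma path_form_extend (i i' j : 'I_(2 * n)) : i' = i.+1 :> nat -> (i' <= j)%N ->
  form_comm K (delta_mx i i) (symmetrize (delta_mx i' j)) =
  symmetrize (delta_mx i j).
Proof.
move=> ii' i'j; have Kii' : K i i' = 1.
  rewrite mxE ii' eqxx; have -> : (i == i.+2 :> nat) = false by lia.
  by rewrite subr0.
have antisym := @path_form_antisym R (2 * n).
rewrite [RHS]symmetrize_delta; last by lia.
have [i'_lt_j|j_le_i'] := ltnP i' j.
  rewrite symmetrize_delta // form_comm_sym_unit // Kii' path_form_far; last by lia.
  by rewrite scale0r addr0 scale1r.
have -> : j = i' by apply: val_inj; rewrite /=; lia.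
by rewrite symmetrize_delta_diag form_comm_square // Kii' scale1r.
Qed.

Lemma sp_gen_far (i j : 'I_(2 * n)) : (1 < `|i - j|)%N ->
  lieb (sp_gen i) (sp_gen j) = 0.
Proof.
move=> ij; rewrite /sp_gen liebZl liebZr; apply: sp_val_inj.
by rewrite !sp_valZ sp_square_comm path_form_far // scale0r raddf0 !scaler0.
Qed.

Lemma sp_gen_near (i j : 'I_(2 * n)) : `|i - j|%N = 1%N ->
  lieb (sp_gen i) (lieb (sp_gen i) (sp_gen j)) = - 2%:R *: sp_gen i.
Proof.
move=> ij; rewrite /sp_gen !(liebZl, liebZr) sp_square_comm2 path_form_near //.
rewrite !scalerA mulr1; congr (_ *: _).
have -> : (-1) ^+ j = - (-1) ^+ i :> R.
  rewrite -signr_odd -[(-1) ^+ i]signr_odd -signrN.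
  by congr (_ ^+ nat_of_bool _); lia.
by rewrite -expr2 sqrr_sign mul1r mulrC mulrN mulNr.
Qed.

Definition el_sp_spec (f : el2n R n -> sp2n R n) :=
  is_lie_morphism f /\ forall i, f (lp_gen (@el_rel R n) i) = sp_gen i.

Lemma el_sp_exists : exists f, el_sp_spec f.
Proof.
have [|f [fm fg] _] := @lie_pres_univ _ _ (@el_rel R n) (sp2n R n) sp_gen.
  by move=> s t [i j ij|i j ij] /=; [exact: sp_gen_far | exact: sp_gen_near].
by exists f.
Qed.

Section Morphism.
Variable f : el2n R n -> sp2n R n.
Hypothesis f_spec : el_sp_spec f.

Lemma el_sp_chain d (i j : 'I_(2 * n)) : (i + d = j)%N ->
  sp_val (f (chain (el_gen R n) i d)) =
  sp_of_form (chain_sign R i d *: symmetrize (delta_mx i j)).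
Proof.
case: f_spec => [[fD fZ fB] fg].
have fe (k : 'I_(2 * n)) : f (el_gen R n k) = sp_gen k by rewrite el_gen_ord.
elim: d i => [|d IH] i ij.
  have -> : j = i by apply: val_inj; rewrite /= -ij addn0.
  by rewrite /= fe mulr1 symmetrize_delta_diag linearZ.
have i1 : (i.+1 < 2 * n)%N by have := ltn_ord j; lia.
have /IH /= {}IH : (Ordinal i1 + d = j)%N by rewrite /=; lia.
rewrite [chain _ _ _]/= [chain_sign _ _ _]/= fB fe /sp_gen liebZl sp_valZ.
rewrite (sp_lieb_of_form (sp_squareE i) IH) form_commZr -sp_of_formZ scalerA.
by rewrite (path_form_extend (i' := Ordinal i1)) //= -ij; lia.
Qed.

Lemma el_sp_comb (T : 'M[R]_(2 * n)) :
  sp_val (f (chain_comb T)) = sp_of_form (symmetrize T).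
Proof.
case: f_spec => [[fD fZ fB] fg].
pose h x := sp_val (f x).
have hD x y : h (x + y) = h x + h y by rewrite /h fD.
have hZ a x : h (a *: x) = a *: h x by rewrite /h fZ.
have h0 : h 0 = 0 by rewrite -(scale0r 0) hZ scale0r.
rewrite -[LHS]/(h _) symmetrize_sum /chain_comb (big_morph h hD h0) raddf_sum /=.
apply: eq_bigr => i _; rewrite (big_morph h hD h0) raddf_sum /=.
apply: eq_bigr => j ij; rewrite hZ /h (@el_sp_chain _ i j) ?subnKC //.
by rewrite -sp_of_formZ scalerA mulrAC chain_sign_sqr mul1r.
Qed.

(** Equal images have equal upper triangles, hence come from the same combination
    of chains; in particular the chains are independent because their images are. *)
Lemma el_sp_inj : injective f.
Proof.
move=> x y; have [T ->] := chain_comb_surj x; have [U ->] := chain_comb_surj y.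
move=> /(congr1 (@sp_val R n)); rewrite !el_sp_comb => /sp_of_form_inj TU.
apply: eq_bigr => i _; apply: eq_bigr => j ij.
by move/matrixP/(_ i j): TU; rewrite !mxE ij => ->.
Qed.

Lemma el_sp_surj M : exists x, f x = M.
Proof.
have [T sT TM] := sp_of_form_surj (sp_valP M).
by exists (chain_comb T); apply: sp_val_inj; rewrite el_sp_comb symmetrize_id.
Qed.

End Morphism.
End Comparison.

Theorem theorem3p1 (R : realType) (n : nat) (hn : (1 <= n)%N) :
  lie_isomorphic (el2n R n) (sp2n R n).
Proof.
have [f fs] := el_sp_exists R n.
exists f; split; first by case: fs.
have [g fgK] := choice (el_sp_surj fs).
by exists g => // x; apply: (el_sp_inj fs); rewrite fgK.
Qed.
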